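(* Let $F$ be a graph with a cut-vertex $v$, and let $G^1,G^2,\dots,G^m$ be all the $v$-components of $F$. If $k$ is an integer with $2\leq k<\min\{\delta(G^i)\mid 1\leq i\leq m\}$, then \[ \sum_{i=1}^m \gamma_{\times k,t}(G^i_I)-m(k+1)+k\leq \gamma_{\times k,t}(F_I)\leq \sum_{i=1}^m\gamma_{\times k,t}(G^i_I). \] Moreover, the upper bound $\sum_{i=1}^m\gamma_{\times k,t}(G^i_I)$ is sharp, i.e. it is attained (with equality) by some such graphs $F$.
   Context: All graphs are finite, simple and undirected. A vertex $v$ of a connected graph $F$ is a cut-vertex if $F-v$ is disconnected. If $S$ is the vertex set of a connected component of $F-v$, the subgraph of $F$ induced by $S\cup\{v\}$ is called a $v$-component of $F$. For a graph $G$ without isolated vertices, the inflated graph $G_I$ is obtained as follows: each vertex $x_i$ of $G$ of degree $d(x_i)$ is replaced by a clique $X_i\cong K_{d(x_i)}$ whose vertices are labelled $x_ix_j$, one for each neighbour $x_j$ of $x_i$; and each edge $x_ix_j$ of $G$ is replaced by the edge joining $x_ix_j\in X_i$ to $x_jx_i\in X_j$. For an integer $k\geq1$, a set $S\subseteq V(H)$ is a $k$-tuple total dominating set of a graph $H$ if every vertex of $H$ has at least $k$ neighbours in $S$; $\gamma_{\times k,t}(H)$ denotes the minimum cardinality of such a set. *)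

(* Defs.v *)
From mathcomp Require Import all_boot.

Set Implicit Arguments.
Unset Strict Implicit.
Unset Printing Implicit Defensive.

Record sgraph := SGraph {
  vertex :> finType;
  edge : rel vertex;
  edge_sym : symmetric edge;
  edge_irr : irreflexive edge }.

Definition degree (G : sgraph) (x : G) : nat := #|[set y | edge x y]|.

(* Since degree x <= #|G| always, the default value #|G| of the iterated       *)
(* minimum is only relevant for the graph with no vertex.                      *)
Definition min_degree (G : sgraph) : nat :=
  \big[minn/#|G|]_(x : G) degree x.

Definition connected (G : sgraph) : bool :=
  [forall x : G, forall y : G, connect (@edge G) x y].

Definition components (G : sgraph) : {set {set G}} :=
  [set [set y | connect (@edge G) x y] | x : G].

Section Induced.
Variables (G : sgraph) (A : {set G}).

Definition induced_vertex : finType := {x : G | x \in A}.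

Definition induced_edge : rel induced_vertex :=
  fun x y => edge (val x) (val y).

Lemma induced_edge_sym : symmetric induced_edge.
Proof. by move=> x y; exact: edge_sym. Qed.

Lemma induced_edge_irr : irreflexive induced_edge.
Proof. by move=> x; exact: edge_irr. Qed.

Definition induced : sgraph := SGraph induced_edge_sym induced_edge_irr.
End Induced.

Definition del_vertex (F : sgraph) (v : F) : sgraph := induced [set~ v].

Definition cut_vertex (F : sgraph) (v : F) : bool :=
  connected F && ~~ connected (del_vertex v).

(* A v-component of F is [induced A] for A in [vcomps v]. As v belongs to no   *)
(* component S of F - v, distinct S give distinct sets A = v |: S.             *)
Definition vcomps (F : sgraph) (v : F) : {set {set F}} :=
  [set v |: [set val x | x in S] | S : {set del_vertex v} in components (del_vertex v)].

Section Inflation.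
Variable G : sgraph.

(* The pair (x, y) is the vertex "xy" of the clique replacing x.               *)
Definition inflated_vertex : finType := {p : G * G | edge p.1 p.2}.

Definition inflated_edge : rel inflated_vertex := fun p q =>
  ((val p).1 == (val q).1) && (p != q)
  || ((val p).1 == (val q).2) && ((val p).2 == (val q).1).

Lemma inflated_edge_sym : symmetric inflated_edge.
Proof.
move=> p q; rewrite /inflated_edge; congr (_ && ~~ _ || _).
- exact: eq_sym.
- exact: eq_sym.
by rewrite andbC; congr (_ && _); exact: eq_sym.
Qed.

Lemma inflated_edge_irr : irreflexive inflated_edge.
Proof.
move=> [[x y] /= xy]; rewrite /inflated_edge /= !eqxx /=.
by apply/negP=> /andP[/eqP exy _]; rewrite exy edge_irr in xy.
Qed.

Definition inflated : sgraph := SGraph inflated_edge_sym inflated_edge_irr.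
End Inflation.

Definition ktuple_total_dominating (H : sgraph) (k : nat) (S : {set H}) : bool :=
  [forall x : H, k <= #|[set y in S | edge x y]|].

(* If H has a k-tuple total dominating set, this is the minimum cardinality    *)
(* of such a set, the default value #|H| being an upper bound of every #|S|.   *)
Definition gamma_kt (H : sgraph) (k : nat) : nat :=
  \big[minn/#|H|]_(S : {set H} | ktuple_total_dominating k S) #|S|.

(* min { delta(G^i) }: every delta(G^i) is at most #|F|, and there is at least  *)
(* one G^i when v is a cut-vertex, so the default value #|F| plays no role.    *)
Definition min_degree_vcomps (F : sgraph) (v : F) : nat :=
  \big[minn/#|F|]_(A in vcomps v) min_degree (induced A).

(* Main.v *)
(* The vertices of F_I are the arcs of F, and each arc lies in exactly one     *)
(* v-component, so everything takes place in sets of arcs of F. The union of   *)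
(* optimal sets of the components gives the upper bound. Conversely, let S be  *)
(* optimal for F. An arc of A not leaving v has all its neighbours in A, so    *)
(* the trace of S on A becomes dominating once A has k + 1 selected arcs       *)
(* leaving v. Since k >= 2, S already has k arcs leaving v, and they pay for   *)
(* the term + k.                                                               *)
(*   Sharpness, with k = 2: v is joined to two copies of 2 K_2, each copy      *)
(* being joined to a hub of its own as well. Each of the 8 vertices of these   *)
(* copies forces 3 selected arcs, whereas v forces none, so F_I needs 24 arcs; *)
(* two triangles in each component, one through v and one through the hub,     *)
(* select 24 arcs that dominate both components.                               *)
Require Import Defs.
From mathcomp Require Import all_boot all_order all_algebra.
From mathcomp Require Import zify.

Set Implicit Arguments.
Unset Strict Implicit.
Unset Printing Implicit Defensive.

(** With [t_A] the number of selected arcs of [A] leaving [v], [vcomp_repair] completes the trace on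
    [A] at a price of at most [k.+1 - t_A] arcs. Summed over the m components, these prices equal
    m(k+1) minus the sum of the [t_A] cut off at [k.+1], and that sum is at least [k] by
    [card_out_dominating] and [sum_minn_geq]. The upper bound is [gamma_kt_leq_vcomps]; in the
    example, [ex_arcs_leq] and [ex_side_dominating] squeeze both sides at 24. *)

Lemma bigmin_leq (I : finType) (P : pred I) (f : I -> nat) (d : nat) (j : I) :
  P j -> \big[minn/d]_(i | P i) f i <= f j.
Proof.
move=> Pj; have : j \in index_enum I by rewrite mem_index_enum.
elim: (index_enum I) => // i s IHs; rewrite inE big_cons => /orP[/eqP <-|/IHs].
  by rewrite Pj geq_minl.
by case: (P i) => // le_sj; rewrite geq_min le_sj orbT.
Qed.

Lemma subset_of_card (T : finType) (A : {set T}) (n : nat) :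
  n <= #|A| -> exists2 B : {set T}, B \subset A & #|B| = n.
Proof.
case/card_geqP=> s [uniq_s <- sA]; exists [set x in s].
  by apply/subsetP=> x; rewrite inE => /sA.
by rewrite cardsE; exact/card_uniqP.
Qed.

Lemma leq_bigmin (I : finType) (P : pred I) (f : I -> nat) (d c : nat) :
  c <= d -> (forall i, P i -> c <= f i) -> c <= \big[minn/d]_(i | P i) f i.
Proof.
by move=> le_cd le_cf; elim/big_ind: _ => // a b ca cb; rewrite leq_min ca cb.
Qed.

Lemma bigmin_attained (I : finType) (P : pred I) (f : I -> nat) (d : nat) :
  \big[minn/d]_(i | P i) f i = d
  \/ exists2 i, P i & \big[minn/d]_(i | P i) f i = f i.
Proof.
elim/big_ind: _; first by left.
- by move=> a b Ka Kb; rewrite /minn; case: ifP.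
by move=> i Pi; right; exists i.
Qed.

(** The default value [#|H|] is itself the size of the full vertex set, which dominates by
    hypothesis. *)
Lemma gamma_kt_attained (H : sgraph) (k : nat) :
  @ktuple_total_dominating H k setT ->
  exists2 S : {set H}, ktuple_total_dominating k S & #|S| = gamma_kt H k.
Proof.
move=> domT; rewrite /gamma_kt.
have [->|[S domS ->]] := bigmin_attained (@ktuple_total_dominating H k)
  (fun S : {set H} => #|S|) #|H|; last by exists S.
by exists setT; rewrite // cardsT.
Qed.

(** * Inflated graphs as sets of arcs *)

(** Adjacency of the inflated graph on bare pairs: the dominating sets of all components live in the
    one type [F * F], where they can be united and intersected. *)
Definition arc_adj (T : eqType) (p q : T * T) : bool :=
  (p.1 == q.1) && (p != q) || (p.1 == q.2) && (p.2 == q.1).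

Definition arcs (F : sgraph) (A : {set F}) : {set F * F} :=
  [set p | [&& p.1 \in A, p.2 \in A & edge p.1 p.2]].

Definition arc_dominating (F : sgraph) (A : {set F}) (k : nat)
    (R : {set F * F}) : Prop :=
  forall p, p \in arcs A -> k <= #|[set q in R | arc_adj p q]|.

Section Embedding.
Variables (F H : sgraph) (f : H -> F) (A : {set F}) (k : nat).
Hypothesis f_inj : injective f.
Hypothesis f_edge : forall x y, edge (f x) (f y) = edge x y.
Hypothesis f_im : f @: [set: H] = A.

(** The embedding [f] will be [val] for an induced subgraph and [id] for [F] itself, so one transfer
    serves both. *)
Definition arc_of (p : inflated H) : F * F := (f (val p).1, f (val p).2).

Lemma arc_of_inj : injective arc_of.
Proof.
move=> p q [/f_inj e1 /f_inj e2]; apply: val_inj.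
by rewrite (surjective_pairing (val p)) e1 e2 -surjective_pairing.
Qed.

Lemma arc_of_arcs p : arc_of p \in arcs A.
Proof.
by rewrite inE /arc_of /= f_edge -f_im !imset_f ?inE //; exact: (valP p).
Qed.

Lemma arcs_arc_of p : p \in arcs A -> exists q, p = arc_of q.
Proof.
case: p => a b; rewrite inE /= -f_im => /and3P[/imsetP[x _ ->] /imsetP[y _ ->]].
by rewrite f_edge => xy; exists (Sub (x, y) xy : inflated_vertex H).
Qed.

Lemma arc_of_adj p q : arc_adj (arc_of p) (arc_of q) = edge p q.
Proof.
by rewrite /arc_adj (inj_eq arc_of_inj) /arc_of /= !(inj_eq f_inj).
Qed.

Lemma card_arc_of_adj (S : {set inflated H}) p :
  #|[set q in arc_of @: S | arc_adj (arc_of p) q]| = #|[set q in S | edge p q]|.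
Proof.
rewrite -(card_imset _ arc_of_inj); congr #|pred_of_set _|; apply/setP=> q.
rewrite inE; apply/andP/imsetP=> [[/imsetP[r rS ->]]|[r]].
  by rewrite arc_of_adj => pr; exists r; rewrite // inE rS.
by rewrite inE => /andP[rS pr] ->; rewrite arc_of_adj imset_f.
Qed.

Lemma gamma_kt_leq_arcs (R : {set F * F}) :
  R \subset arcs A -> arc_dominating A k R -> gamma_kt (inflated H) k <= #|R|.
Proof.
move=> sRA domR; pose S : {set inflated H} := arc_of @^-1: R.
have defR : arc_of @: S = R.
  apply/setP=> p; apply/imsetP/idP=> [[q]|pR]; first by rewrite inE => qR ->.
  have [q defp] := arcs_arc_of (subsetP sRA _ pR).
  by exists q; rewrite // inE -defp.
rewrite -defR (card_imset _ arc_of_inj); apply: bigmin_leq.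
apply/forallP=> p; rewrite -card_arc_of_adj defR; exact/domR/arc_of_arcs.
Qed.

Lemma arcs_gamma_kt :
  arc_dominating A k (arcs A) ->
  exists R : {set F * F}, [/\ R \subset arcs A, arc_dominating A k R
                           & #|R| = gamma_kt (inflated H) k].
Proof.
move=> domA; have imT : arc_of @: [set: inflated H] = arcs A.
  apply/setP=> p; apply/imsetP/idP=> [[q _ ->]|/arcs_arc_of[q ->]].
    exact: arc_of_arcs.
  by exists q.
have [|S /forallP domS <-] := @gamma_kt_attained (inflated H) k.
  apply/forallP=> p; rewrite -card_arc_of_adj imT; exact/domA/arc_of_arcs.
exists (arc_of @: S); split; last exact: (card_imset _ arc_of_inj).
  by apply/subsetP=> _ /imsetP[q _ ->]; exact: arc_of_arcs.
by move=> _ /arcs_arc_of[q ->]; rewrite card_arc_of_adj.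
Qed.

Lemma degree_embedding x : degree x = #|[set z in A | edge (f x) z]|.
Proof.
rewrite /degree -(card_imset _ f_inj); congr #|pred_of_set _|; apply/setP=> z.
rewrite inE -f_im; apply/imsetP/andP=> [[y]|[/imsetP[y _ ->]]].
  by rewrite inE => xy ->; rewrite f_edge imset_f.
by rewrite f_edge => xy; exists y; rewrite // inE.
Qed.
End Embedding.

Lemma imset_val_induced (F : sgraph) (A : {set F}) :
  val @: [set: induced A] = A.
Proof.
apply/setP=> x; apply/imsetP/idP=> [[y _ ->]|xA]; first exact: (valP y).
by exists (Sub x xA : induced_vertex A).
Qed.

Lemma imset_id_setT (F : sgraph) : id @: [set: F] = [set: F].
Proof. exact: imset_id. Qed.

Lemma degree_induced (F : sgraph) (A : {set F}) (x : induced A) :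
  degree x = #|[set z in A | edge (val x) z]|.
Proof.
by apply: (degree_embedding (H := induced A)) => //; [exact: val_inj |
  exact: imset_val_induced].
Qed.

Lemma card_out_arcs (F : sgraph) (A : {set F}) x : x \in A ->
  #|[set p in arcs A | p.1 == x]| = #|[set z in A | edge x z]|.
Proof.
move=> xA; have inj : injective (fun z : F => (x, z)) by move=> ? ? [].
rewrite -(card_imset _ inj); congr #|pred_of_set _|; apply/setP=> -[a b].
rewrite !inE /=; apply/andP/imsetP=> [[/and3P[_ bA ab] /eqP ax]|[z]].
  by exists b; rewrite ?inE -ax ?bA.
by rewrite inE => /andP[zA xz] [-> ->]; rewrite xA zA xz.
Qed.

(* Two arcs leaving the same vertex are adjacent, so k + 1 of them dominate *)
(* every arc leaving that vertex.                                           *)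
Lemma out_arcs_adj (F : sgraph) (R U : {set F * F}) (k : nat) p :
  U \subset R -> {in U, forall q, q.1 = p.1} -> k < #|U| ->
  k <= #|[set q in R | arc_adj p q]|.
Proof.
move=> sUR U1 ltkU; have : k <= #|U :\ p|.
  by move: ltkU; rewrite (cardsD1 p U); case: (p \in U) => //= /ltnW.
move=> /leq_trans; apply; apply: subset_leq_card; apply/subsetP=> q.
rewrite !inE => /andP[neq_qp qU]; rewrite (subsetP sUR) // /arc_adj.
by rewrite (U1 q) // eqxx eq_sym neq_qp.
Qed.

Lemma arcs_dominating (F : sgraph) (A : {set F}) (k : nat) :
  {in A, forall x, k < #|[set z in A | edge x z]|} ->
  arc_dominating A k (arcs A).
Proof.
move=> degA p pA; have xA : p.1 \in A by move: pA; rewrite inE => /and3P[].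
apply: (@out_arcs_adj _ _ [set q in arcs A | q.1 == p.1]).
- by apply/subsetP=> q; rewrite inE => /andP[].
- by move=> q; rewrite inE => /andP[_ /eqP].
by rewrite card_out_arcs // degA.
Qed.

(** * The v-components and their arcs *)

Section VComponents.
Variables (F : sgraph) (v : F).

Lemma vcompsP (A : {set F}) :
  reflect (exists x : del_vertex v,
             A = v |: [set val y | y in [set y | connect (@edge _) x y]])
          (A \in vcomps v).
Proof.
apply: (iffP imsetP) => [[_ /imsetP[x _ ->] ->]|[x ->]]; first by exists x.
by exists [set y | connect (@edge _) x y]; rewrite // imset_f.
Qed.

Lemma vcomps_center A : A \in vcomps v -> v \in A.
Proof. by case/vcompsP=> x ->; rewrite setU11. Qed.

Lemma mem_vcomp (x y : del_vertex v) :
  (val y \in v |: [set val y | y in [set y | connect (@edge _) x y]])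
  = connect (@edge _) x y.
Proof.
have yv : val y != v by have := valP y; rewrite !inE.
rewrite !inE (negPf yv) /=; rewrite mem_imset ?inE //; exact: val_inj.
Qed.

Lemma del_vertexP x : x != v -> exists y : del_vertex v, x = val y.
Proof.
move=> xv; have xv' : x \in [set~ v] by rewrite !inE.
by exists (Sub x xv' : induced_vertex [set~ v]).
Qed.

(** An edge at a vertex other than [v] either ends in [v], which lies in [A], or survives in F - v
    and stays in the component. *)
Lemma vcomps_closed A x z :
  A \in vcomps v -> x \in A -> x != v -> edge x z -> z \in A.
Proof.
case/vcompsP=> y -> xA /del_vertexP[x' defx] xz; move: xA xz; rewrite {x}defx.
have [->|/del_vertexP[z' ->]] := eqVneq z v; first by rewrite setU11.
rewrite !mem_vcomp => yx xz; exact: connect_trans yx (connect1 _).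
Qed.

Lemma vcomps_cover x : x != v -> exists2 A, A \in vcomps v & x \in A.
Proof.
case/del_vertexP=> y ->.
exists (v |: [set val z | z in [set z | connect (@edge _) y z]]).
  by apply/vcompsP; exists y.
by rewrite mem_vcomp.
Qed.

Lemma vcomps_uniq A B x : A \in vcomps v -> B \in vcomps v ->
  x \in A -> x \in B -> x != v -> A = B.
Proof.
have sym := sym_connect_sym (@edge_sym (del_vertex v)).
case/vcompsP=> a -> /vcompsP[b ->] + + /del_vertexP[y defx].
rewrite defx !mem_vcomp => ay b_y.
suff -> : [set z | connect (@edge _) a z] = [set z | connect (@edge _) b z] by [].
apply/setP=> z; rewrite !inE; apply: (same_connect sym).
by apply: connect_trans ay _; rewrite sym.
Qed.

(** There are no loops, so an arc has an end other than [v], and that end determines the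
    v-component. *)
Lemma vcomps_arc p : p \in arcs [set: F] ->
  exists2 A, A \in vcomps v & forall B, B \in vcomps v -> (p \in arcs B) = (B == A).
Proof.
case: p => x y; rewrite !inE /= => xy.
have [u [uv uxy]] : exists u, u != v /\ (u = x \/ u = y).
  have [xv|] := eqVneq x v; last by exists x; split=> //; left.
  exists y; split; last by right.
  by apply: contraTneq xy => ->; rewrite xv edge_irr.
have [A vA uA] := vcomps_cover uv.
exists A => // B vB; rewrite inE /= xy andbT; apply/andP/eqP=> [[xB yB]|->].
  by case: uxy => defu; apply: (vcomps_uniq vB vA) uA uv; rewrite defu.
case: uxy => defu; rewrite -defu in xy *; split=> //.
  exact: vcomps_closed xy.
by rewrite edge_sym in xy; exact: vcomps_closed xy.
Qed.

Lemma vcomps_sum_card (R : {set F * F}) : R \subset arcs [set: F] ->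
  \sum_(A in vcomps v) #|R :&: arcs A| = #|R|.
Proof.
move=> /subsetP sR; rewrite -sum1_card.
under eq_bigr => A _ do rewrite -sum1_card.
under eq_bigr => A _ do under eq_bigl => p do rewrite inE.
under eq_bigr => A _ do rewrite big_mkcondr.
rewrite exchange_big /=; apply: eq_bigr => p pR.
have [A vA pA] := vcomps_arc (sR p pR).
rewrite (bigD1 A) //= pA // eqxx big1 // => B /andP[vB neqBA].
by rewrite pA // (negPf neqBA).
Qed.

Lemma arcsS (A B : {set F}) : A \subset B -> arcs A \subset arcs B.
Proof.
move=> /subsetP sAB; apply/subsetP=> p; rewrite !inE => /and3P[pA qA ->].
by rewrite !sAB.
Qed.

(** The neighbours of an arc xy are the other arcs leaving x, which stay in [A] when x is not [v],
    and the reverse yx, which has the same ends. *)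
Lemma vcomp_arc_adj A p q : A \in vcomps v -> p \in arcs A -> p.1 != v ->
  q \in arcs [set: F] -> arc_adj p q -> q \in arcs A.
Proof.
move=> vA; case: p q => [x y] [a b]; rewrite !inE /arc_adj /=.
move=> /and3P[xA yA xy] xv ab /orP[/andP[/eqP defa _]|/andP[/eqP defb /eqP defa]].
  by rewrite -defa in ab *; rewrite xA ab (vcomps_closed vA xA).
by rewrite -defa -defb in ab *; rewrite yA xA ab.
Qed.

Lemma vcomp_degree k A x : k < min_degree_vcomps v -> A \in vcomps v ->
  x \in A -> k < #|[set z in A | edge x z]|.
Proof.
move=> ltk vA xA; pose x' : induced A := Sub x xA : induced_vertex A.
have -> : #|[set z in A | edge x z]| = degree x' by rewrite degree_induced.
apply: leq_trans (_ : min_degree (induced A) <= _); last exact: bigmin_leq.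
apply: leq_trans ltk _; exact: (bigmin_leq (fun A => min_degree (induced A))).
Qed.

Lemma gamma_kt_vcomp_leq k A (R : {set F * F}) :
  R \subset arcs A -> arc_dominating A k R ->
  gamma_kt (inflated (induced A)) k <= #|R|.
Proof.
apply: (gamma_kt_leq_arcs (f := val : induced A -> F)) => //.
  exact: val_inj.
exact: imset_val_induced.
Qed.

(** * The upper bound *)

(** In the union of optimal sets, an arc keeps the neighbours it has in the set of its own
    component. The degree bound ensures that each component has a dominating set. *)
Lemma gamma_kt_leq_vcomps k : k < min_degree_vcomps v ->
  gamma_kt (inflated F) k
    <= \sum_(A in vcomps v) gamma_kt (inflated (induced A)) k.
Proof.
move=> ltk.
have /fin_all_exists[R RP] A : exists R : {set F * F}, A \in vcomps v ->
    [/\ R \subset arcs A, arc_dominating A k R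
      & #|R| = gamma_kt (inflated (induced A)) k].
  have [vA|_] := boolP (A \in vcomps v); last by exists set0.
  have [] := @arcs_gamma_kt F (induced A) val A k val_inj _ _ _ => //.
  - exact: imset_val_induced.
  - by apply: arcs_dominating => x; exact: vcomp_degree.
  by move=> R RP; exists R.
pose U := \bigcup_(A in vcomps v) R A.
apply: (@leq_trans #|U|).
  apply: (gamma_kt_leq_arcs (f := id) (A := setT)) => //.
  - exact: imset_id_setT.
  - apply/bigcupsP=> A vA; have [sRA _ _] := RP A vA.
    exact: subset_trans sRA (arcsS (subsetT _)).
  move=> p pF; have [A vA pA] := vcomps_arc pF.
  have [_ domA _] := RP A vA.
  have {}pA : p \in arcs A by rewrite pA.
  apply: leq_trans (domA p pA) _; apply: subset_leq_card.
  apply/subsetP=> q; rewrite !inE => /andP[qR ->]; rewrite andbT.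
  by apply/bigcupP; exists A.
have -> : \sum_(A in vcomps v) gamma_kt (inflated (induced A)) k
    = \sum_(A in vcomps v) #|R A|.
  by apply: eq_bigr => A vA; have [] := RP A vA.
rewrite /U; elim/big_rec2: _ => [|A n B _ leBn]; first by rewrite cards0.
by apply: leq_trans (leq_card_setU _ _) _; rewrite leq_add2l.
Qed.

(** * The lower bound *)

Lemma vcomps_neq0 : cut_vertex v -> exists A, A \in vcomps v.
Proof.
case/andP=> _; rewrite negb_forall => /existsP[x _].
have [|A vA _] := @vcomps_cover (val x); last by exists A.
by have := valP x; rewrite !inE.
Qed.

(* If no arc leaving v is chosen, an arc vy has at most the one chosen       *)
(* neighbour yv, which is too few; otherwise count around a chosen arc vy.   *)
Lemma card_out_dominating k (R : {set F * F}) p : 1 < k ->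
  arc_dominating [set: F] k R -> R \subset arcs [set: F] ->
  p \in arcs [set: F] -> p.1 = v -> k <= #|[set q in R | q.1 == v]|.
Proof.
move=> k2 domR sR pF pv; set X := [set q in R | _].
(* The only neighbour of [q] outside the clique at [v] is its reverse, which accounts for the
   successor. *)
have bound q : q \in arcs [set: F] -> q.1 = v -> k <= #|X :\ q|.+1.
  move=> qF qv; apply: leq_trans (domR q qF) _.
  apply: leq_trans (_ : #|(q.2, q.1) |: X :\ q| <= _); last first.
    by rewrite cardsU1 -add1n leq_add2r leq_b1.
  apply: subset_leq_card; apply/subsetP=> r; rewrite !inE /arc_adj.
  case/andP=> -> /orP[/andP[/eqP <- qr]|/andP[/eqP q1 /eqP q2]].
    by rewrite [r == q]eq_sym qr qv eqxx orbT.
  by rewrite q1 q2 -surjective_pairing eqxx.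
have [X0|[q qX]] := set_0Vmem X.
  by have := bound p pF pv; rewrite X0 set0D cards0 leqNgt k2.
have := qX; rewrite inE => /andP[qR /eqP qv].
by have := bound q (subsetP sR _ qR) qv; rewrite (cardsD1 q X) qX.
Qed.

(** Since [v] has more than [k] neighbours in [A], unselected arcs of [A] leaving [v] can be added
    until there are [k.+1]. These dominate the arcs leaving [v]; every other arc of [A] keeps all
    its neighbours in [R]. *)
Lemma vcomp_repair k A (R : {set F * F}) : k < min_degree_vcomps v ->
  A \in vcomps v -> R \subset arcs [set: F] -> arc_dominating [set: F] k R ->
  gamma_kt (inflated (induced A)) k
    <= #|R :&: arcs A| + (k.+1 - #|[set q in R | q.1 == v] :&: arcs A|).
Proof.
move=> ltk vA sR domR; have vinA := vcomps_center vA.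
set T := [set q in R | q.1 == v] :&: arcs A.
pose X := [set q in arcs A | q.1 == v].
have sTX : T \subset X.
  apply/subsetP=> q; rewrite in_setI !in_set => /andP[/andP[_ ->]].
  by rewrite andbT.
have ltkX : k < #|X| by rewrite card_out_arcs // vcomp_degree.
(* The subtraction is truncated: [U] is empty when [T] already has more than [k] arcs. *)
have [|U sUX cardU] := @subset_of_card _ (X :\: T) (k.+1 - #|T|).
  by rewrite cardsDS // leq_sub2r.
have TU0 : T :&: U = set0.
  apply/setP=> q; rewrite in_setI in_set0; apply/negP=> /andP[qT /(subsetP sUX)].
  by rewrite in_setD qT.
rewrite -cardU; apply: leq_trans (leq_card_setU _ _).
apply: gamma_kt_vcomp_leq.
  rewrite subUset subsetIr; apply/subsetP=> q /(subsetP sUX).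
  by rewrite !inE => /andP[_ /andP[]].
move=> p pA; have [pv|pv] := eqVneq p.1 v.
  apply: (@out_arcs_adj _ _ (T :|: U)).
  - apply: setSU; apply: setSI; apply/subsetP=> q.
    by rewrite inE => /andP[].
  - move=> q; rewrite pv in_setU => /orP[/(subsetP sTX)|/(subsetP sUX)].
      by rewrite inE => /andP[_ /eqP].
    by rewrite !inE => /andP[_ /andP[_ /eqP]].
  by rewrite cardsU TU0 cards0 cardU; lia.
apply: leq_trans (domR p _) _; first exact: subsetP (arcsS (subsetT A)) p pA.
apply: subset_leq_card; apply/subsetP=> q.
rewrite !in_set => /andP[qR pq]; rewrite qR pq andbT; apply/orP; left.
by have := vcomp_arc_adj vA pA pv (subsetP sR q qR) pq; rewrite inE.
Qed.

(** A single term above [k] contributes [k.+1] after truncation; if there is none, truncation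
    changes nothing. *)
Lemma sum_minn_geq (I : finType) (P : pred I) (t : I -> nat) (k : nat) :
  k <= \sum_(i | P i) t i -> k <= \sum_(i | P i) minn (t i) k.+1.
Proof.
move=> le_k; case: (pickP [pred i | P i & k < t i]) => [i /andP[Pi ltk]|tk].
  by rewrite (bigD1 i) //= (minn_idPr ltk); lia.
rewrite (eq_bigr t) // => i Pi; apply/minn_idPl.
by have := tk i; rewrite inE Pi /= => /negbT; lia.
Qed.

Lemma vcomps_leq_gamma_kt k : cut_vertex v -> 1 < k < min_degree_vcomps v ->
  \sum_(A in vcomps v) gamma_kt (inflated (induced A)) k + k
    <= gamma_kt (inflated F) k + #|vcomps v| * k.+1.
Proof.
move=> cutv /andP[k2 ltk]; have [A0 vA0] := vcomps_neq0 cutv.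
have [||R [sR domR <-]] := @arcs_gamma_kt F F id setT k (@inj_id _) _ (imset_id_setT F).
- by [].
- apply: arcs_dominating => x _.
  have [A vA xA] : exists2 A, A \in vcomps v & x \in A.
    have [->|] := eqVneq x v; last exact: vcomps_cover.
    by exists A0; rewrite ?vcomps_center.
  apply: leq_trans (vcomp_degree ltk vA xA) _; apply: subset_leq_card.
  by apply/subsetP=> z; rewrite !inE => /andP[_ ->].
set T := [set q in R | q.1 == v].
have cardT : k <= #|T|.
  have := vcomp_degree ltk vA0 (vcomps_center vA0).
  rewrite -card_out_arcs ?vcomps_center //.
  have [->|[p]] := set_0Vmem [set p in arcs A0 | p.1 == v]; first by rewrite cards0.
  rewrite inE => /andP[pA /eqP pv] _.
  apply: (card_out_dominating k2 domR sR _ pv).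
  exact: subsetP (arcsS (subsetT A0)) p pA.
have sT : T \subset arcs [set: F].
  by apply: subset_trans sR; apply/subsetP=> q; rewrite inE => /andP[].
rewrite -(vcomps_sum_card sR) -sum_nat_const.
rewrite -(vcomps_sum_card sT) in cardT.
have {}cardT := sum_minn_geq cardT.
apply: leq_trans (leq_add (leqnn _) cardT) _; rewrite -!big_split /=.
apply: leq_sum => A vA; have := vcomp_repair ltk vA sR domR.
rewrite -/T; move: #|T :&: _| => t le_g.
apply: (leq_trans (leq_add le_g (leqnn _))); rewrite -addnA leq_add2l.
(* Here [(k.+1 - t) + minn t k.+1] is exactly [k.+1], whether or not [t] exceeds [k]. *)
by rewrite minnC minnE subnKC // leq_subr.
Qed.
End VComponents.

(** * A graph attaining the upper bound *)

(* The vertex (i, a, b) lies in copy i, and its only neighbour in that copy  *)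
(* is (i, a, ~~ b). The center is None and the hub of copy i is inr i; the   *)
(* selected triangle of (i, a, b) goes through the center when a holds and   *)
(* through the hub of copy i otherwise.                                      *)
Definition wing : finType := (bool * bool * bool)%type.

Definition ex_vertex : finType := option (wing + bool)%type.

Definition ex_edge : rel ex_vertex := fun x y =>
  match x, y with
  | None, Some (inl _) | Some (inl _), None => true
  | Some (inl s), Some (inl t) => (s.1 == t.1) && (s.2 != t.2)
  | Some (inl s), Some (inr i) | Some (inr i), Some (inl s) => s.1.1 == i
  | _, _ => false
  end.

Lemma ex_edge_sym : symmetric ex_edge.
Proof. by move=> [[[[[] []] []]|[]]|] [[[[[] []] []]|[]]|]. Qed.

Lemma ex_edge_irr : irreflexive ex_edge.
Proof. by move=> [[[[[] []] []]|[]]|]. Qed.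

Definition ex_graph : sgraph := SGraph ex_edge_sym ex_edge_irr.

Definition ex_center : ex_graph := None.

Definition side_of (x : ex_vertex) : bool :=
  match x with None => true | Some (inl s) => s.1.1 | Some (inr i) => i end.

Definition ex_side (i : bool) : {set ex_graph} :=
  [set x : ex_graph | (x == None) || (side_of x == i)].

Definition partner (s : wing) : wing := (s.1, ~~ s.2).

Definition hub (s : wing) : ex_vertex :=
  if s.1.2 then None else Some (inr s.1.1).

Definition selected (x y : ex_vertex) : bool :=
  match x, y with
  | Some (inl s), Some (inl t) => true
  | Some (inl s), h | h, Some (inl s) => h == hub s
  | _, _ => false
  end.

Definition ex_arcs : {set ex_graph * ex_graph} :=
  [set p : ex_graph * ex_graph | ex_edge p.1 p.2 & selected p.1 p.2].

Lemma card_wing : #|wing| = 8.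
Proof. by rewrite !card_prod card_bool. Qed.

(** Each of the 8 wing vertices accounts for three selected arcs: to its partner, to its hub and
    from its hub. *)
Lemma card_ex_arcs : #|ex_arcs| <= 24.
Proof.
have le8 (f : wing -> ex_graph * ex_graph) : #|[set f s | s : wing]| <= 8.
  by rewrite -card_wing; exact: leq_imset_card.
pose inner : {set ex_graph * ex_graph} :=
  [set (Some (inl s), Some (inl (partner s))) | s : wing].
pose out : {set ex_graph * ex_graph} := [set (Some (inl s), hub s) | s : wing].
pose into : {set ex_graph * ex_graph} := [set (hub s, Some (inl s)) | s : wing].
have : ex_arcs \subset inner :|: out :|: into.
  apply/subsetP=> -[x y]; rewrite in_set !in_setU => /andP[/=].
  case: x => [[s|i]|]; case: y => [[t|j]|] //=.
  - move=> st _; have -> : t = partner s.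
      by case: s t st => -[[] []] [] [] [[] []] [].
    by rewrite imset_f.
  - by move=> _ /eqP->; rewrite [X in _ || X || _]imset_f ?orbT.
  - by move=> _ /eqP->; rewrite [X in _ || X || _]imset_f ?orbT.
  - by move=> _ /eqP->; rewrite [X in _ || X]imset_f ?orbT.
  - by move=> _ /eqP->; rewrite [X in _ || X]imset_f ?orbT.
move=> /subset_leq_card/leq_trans -> //; apply: leq_trans (leq_card_setU _ _) _.
apply: (@leq_add _ _ 16 8) (le8 _); apply: leq_trans (leq_card_setU _ _) _.
exact: (leq_add (le8 _) (le8 _)).
Qed.

(** An arc between two wing vertices is charged to its tail, any other arc of the graph to its only
    wing end, so that no arc is charged twice. *)
Definition owner (p : ex_graph * ex_graph) : option wing :=
  match p with
  | (Some (inl s), _) | (_, Some (inl s)) => Some s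
  | _ => None
  end.

(** With an explicit list of candidate neighbours, domination becomes a condition on finitely many
    Boolean memberships. *)
Lemma card_leq_count (T : finType) (R : {set T}) (P : pred T) (l : seq T) :
  {in R, forall q, P q -> q \in l} -> #|[set q in R | P q]| <= count (mem R) l.
Proof.
move=> Pl; rewrite -size_filter; apply: leq_trans (card_size _).
apply: subset_leq_card; apply/subsetP=> q; rewrite inE mem_filter => /andP[qR Pq].
by apply/andP; split=> //; exact: Pl.
Qed.

Lemma count_leq_card (T : finType) (R : {set T}) (P : pred T) (l : seq T) :
  uniq l -> all P l -> count (mem R) l <= #|[set q in R | P q]|.
Proof.
move=> uniq_l /allP Pl; rewrite -size_filter; apply/card_geqP.
exists (filter (mem R) l); split; rewrite ?filter_uniq // => q.
by rewrite mem_filter => /andP[qR /Pl Pq]; rewrite inE; apply/andP.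
Qed.

Lemma ex_edge_wing (s : wing) (z : ex_vertex) : ex_edge (Some (inl s)) z ->
  z \in [:: Some (inl (partner s)); None; Some (inr s.1.1)].
Proof. by case: s => -[[] []] []; case: z => [[[[[] []] []]|[]]|]. Qed.

(* Write a, b, c, d, e for the membership in R of the arcs from s to its      *)
(* partner, to the center and to the other hub, and of the arcs from these    *)
(* two hubs to s. Domination gives a + c + d >= 2, a + b + e >= 2 and         *)
(* b + c >= 1, which force a + b + c + d + e >= 3.                            *)
Lemma owner_geq3 (R : {set ex_graph * ex_graph}) (s : wing) :
  R \subset arcs setT -> arc_dominating setT 2 R ->
  3 <= #|[set p in R | owner p == Some s]|.
Proof.
move=> /subsetP sR domR; pose x : ex_graph := Some (inl s).
pose y : ex_graph := Some (inl (partner s)); pose w : ex_graph := Some (inr s.1.1).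
pose v := ex_center.
have dom t l : ex_edge x t -> (t, x) \in l ->
    {in [:: y; v; w], forall z, z != t -> (x, z) \in l} -> 2 <= count (mem R) l.
  move=> xt tx_l xz_l; apply: leq_trans (domR (x, t) _) _; first by rewrite !inE.
  apply: card_leq_count => -[a b] /sR; rewrite inE => /and3P[_ _ ab].
  rewrite /arc_adj /= => /orP[/andP[/eqP ax]|/andP[/eqP <- /eqP <-]] //.
  rewrite -ax in ab *; rewrite xpair_eqE eqxx /= eq_sym.
  by apply: xz_l; exact: ex_edge_wing.
apply: leq_trans (_ : count (mem R) [:: (x, y); (x, v); (x, w); (v, x); (w, x)] <= _).
  have xy : ex_edge x y by rewrite /= eqxx; case: (s.2).
  have xw : ex_edge x w by exact: eqxx.
  have abe : 2 <= count (mem R) [:: (x, y); (x, v); (w, x)].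
    apply: (dom w); rewrite ?inE ?eqxx ?orbT //.
    by move=> z; rewrite !inE => /or3P[]/eqP->; rewrite ?eqxx ?orbT.
  have acd : 2 <= count (mem R) [:: (x, y); (x, w); (v, x)].
    apply: (dom v); rewrite ?inE ?eqxx ?orbT //.
    by move=> z; rewrite !inE => /or3P[]/eqP->; rewrite ?eqxx ?orbT.
  (* The arc [(y, x)] is owned by the partner and counts for at most 1, whence b + c >= 1. *)
  have bc : 2 <= count (mem R) [:: (x, v); (x, w); (y, x)].
    apply: (dom y); rewrite ?inE ?eqxx ?orbT //.
    by move=> z; rewrite !inE => /or3P[]/eqP->; rewrite ?eqxx ?orbT.
  move: abe acd bc => /=.
  by do 6?[case: (_ \in R)].
apply: count_leq_card; rewrite /x /y /w /v; first by case: (s) => -[[] []] [].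
by rewrite /= !eqxx.
Qed.

Lemma ex_arcs_leq (R : {set ex_graph * ex_graph}) :
  R \subset arcs setT -> arc_dominating setT 2 R -> 24 <= #|R|.
Proof.
move=> sR domR.
apply: (@leq_trans (\sum_(s : wing) #|[set p in R | owner p == Some s]|)).
  rewrite -[24]/(8 * 3) -card_wing -sum_nat_const.
  by apply: leq_sum => s _; exact: owner_geq3.
under eq_bigr => s _ do rewrite -sum1dep_card big_mkcondr.
rewrite exchange_big -sum1_card; apply: leq_sum => p _ /=.
case: (owner p) => [t|]; last by rewrite big1.
rewrite (bigD1 t) //= eqxx big1 // => s /negPf; rewrite eq_sym => neq_st.
by case: eqP => // -[ts]; rewrite ts eqxx in neq_st.
Qed.

Lemma ex_edge_side (x y : ex_vertex) :
  ex_edge x y -> x != None -> y != None -> side_of x = side_of y.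
Proof. by case: x y => [[[[[] []] []]|[]]|] [[[[[] []] []]|[]]|]. Qed.

Lemma ex_edge_hub (x : ex_vertex) : x != None ->
  x != Some (inr (side_of x)) -> ex_edge x (Some (inr (side_of x))).
Proof. by case: x => [[[[[] []] []]|[]]|]. Qed.

(** [side_of] is constant along edges avoiding the center, and every remaining vertex is the hub of
    its side or adjacent to it. *)
Lemma ex_connect (x y : del_vertex ex_center) :
  connect (@edge _) x y = (side_of (val x) == side_of (val y)).
Proof.
have sym := sym_connect_sym (@edge_sym (del_vertex ex_center)).
apply/idP/eqP=> [xy|eq_xy].
  pose a := [pred z : del_vertex ex_center | side_of (val z) == side_of (val y)].
  have cl_a : closed (@edge (del_vertex ex_center)) a.
    move=> z t zt; rewrite !inE (ex_edge_side zt) //.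
      by have := valP z; rewrite !inE.
    by have := valP t; rewrite !inE.
  by have := closed_connect cl_a xy; rewrite !inE eqxx => /eqP.
have to_hub (z : del_vertex ex_center) (h : del_vertex ex_center) :
    val h = Some (inr (side_of (val z))) -> connect (@edge _) z h.
  move=> hP; have [->|neq_zh] := eqVneq z h; first exact: connect0.
  apply: connect1; rewrite -val_eqE hP in neq_zh.
  change (ex_edge (val z) (val h)); rewrite hP; apply: ex_edge_hub neq_zh.
  by have := valP z; rewrite !inE.
have [h hE] := @del_vertexP ex_graph ex_center (Some (inr (side_of (val x)))) isT.
apply: (connect_trans (to_hub x h _)) => //.
by rewrite sym; apply: to_hub; rewrite -eq_xy.
Qed.

Lemma ex_vcomps A : A \in vcomps ex_center -> exists i, A = ex_side i.
Proof.
case/vcompsP=> x ->; exists (side_of (val x)); apply/setP=> y.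
have [->|/del_vertexP[y' ->]] := eqVneq y ex_center.
  by rewrite setU11 inE.
rewrite mem_vcomp ex_connect inE [RHS]orbC eq_sym.
by have := valP y'; rewrite !inE => /negPf->; rewrite orbF.
Qed.

Lemma ex_cut_vertex : cut_vertex ex_center.
Proof.
apply/andP; split.
  have sym := sym_connect_sym (@edge_sym ex_graph).
  have conn_s (s : wing) : connect (@edge ex_graph) (Some (inl s)) None.
    exact: connect1.
  have conn x : connect (@edge ex_graph) x None.
    case: x => [[s|i]|]; [exact: conn_s | | exact: connect0].
    apply: connect_trans (conn_s (i, true, true)); apply: connect1.
    by rewrite /edge /= eqxx.
  apply/forallP=> x; apply/forallP=> y; apply: connect_trans (conn x) _.
  by rewrite sym.
have [h1 h1E] := @del_vertexP ex_graph ex_center (Some (inr true)) isT.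
have [h2 h2E] := @del_vertexP ex_graph ex_center (Some (inr false)) isT.
apply/negP=> /forallP/(_ h1)/forallP/(_ h2).
by rewrite ex_connect -h1E -h2E.
Qed.

(** A wing vertex has exactly the three neighbours listed; the center and the hub are joined to all
    four wing vertices of the side. *)
Lemma ex_side_degree i x : x \in ex_side i ->
  2 < #|[set z in ex_side i | edge x z]|.
Proof.
move=> xi; apply/card_geqP.
exists (match x with
  | Some (inl s) => [:: None; Some (inr i); Some (inl (partner s))]
  | _ => [:: Some (inl (i, true, true)); Some (inl (i, true, false));
             Some (inl (i, false, true))]
  end : seq ex_graph); move: xi; rewrite inE.
by case: i x => [] [[[[[] []] []]|[]]|] //= _; split=> // z; rewrite !inE;
  do ?[case/orP]; move/eqP=> ->.
Qed.

Lemma ex_min_degree : 2 < min_degree_vcomps ex_center.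
Proof.
have deg A (x : induced A) : A \in vcomps ex_center -> 2 < degree x.
  move=> vA; have [i defA] := ex_vcomps vA.
  have degA z : z \in A -> 2 < #|[set t in A | edge z t]|.
    by rewrite defA; exact: ex_side_degree.
  by rewrite degree_induced; exact/degA/(valP x).
apply: leq_bigmin => [|A vA].
  (* The default values of both minima must exceed 2 as well: here the 8 wing vertices suffice,
     below the degree of the center in [A]. *)
  apply: leq_trans (_ : #|wing| <= _); first by rewrite card_wing.
  by apply: (@leq_card _ _ (fun s => Some (inl s))) => s t [].
apply: leq_bigmin => [|x _]; last exact: deg.
pose c : induced A := Sub ex_center (vcomps_center vA) : induced_vertex A.
by apply: leq_trans (deg A c vA) _; exact: max_card.
Qed.

(** Each vertex of a side lies on one selected triangle of that side, so two selected arcs leave it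
    there. An unselected arc sees both of them; a selected arc sees the other one and its own
    reverse. *)
Lemma ex_side_dominating i :
  arc_dominating (ex_side i) 2 (ex_arcs :&: arcs (ex_side i)).
Proof.
case=> x y xy; apply/card_geqP.
pose other (s : wing) : ex_vertex := Some (inl (partner s)).
exists (match x, y with
  | Some (inl s), Some (inl t) => [:: (x, hub s); (y, x)]
  | Some (inl s), h => if h == hub s then [:: (x, other s); (h, x)]
                       else [:: (x, other s); (x, hub s)]
  | h, Some (inl s) => if h == hub s then [:: (y, h); (h, other s)]
      else [:: (h, Some (inl (i, ~~ s.1.2, true)));
               (h, Some (inl (i, ~~ s.1.2, false)))]
  | _, _ => [::]
  end : seq (ex_graph * ex_graph)); move: xy; rewrite !inE /other.
by case: i x y => [] [[[[[] []] []]|[]]|] [[[[[] []] []]|[]]|] //= _;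
  split=> // z; rewrite !inE; do ?[case/orP]; move/eqP=> ->.
Qed.

Theorem theorem3p6 :
  (forall (F : sgraph) (v : F) (k : nat),
     cut_vertex v -> 2 <= k < min_degree_vcomps v ->
     (\sum_(A in vcomps v) (gamma_kt (inflated (induced A)) k)%:Z
        - #|vcomps v|%:Z * (k%:Z + 1) + k%:Z
      <= (gamma_kt (inflated F) k)%:Z)%R
     /\ gamma_kt (inflated F) k
        <= \sum_(A in vcomps v) gamma_kt (inflated (induced A)) k)
  /\
  (exists (F : sgraph) (v : F) (k : nat),
     [/\ cut_vertex v, 2 <= k < min_degree_vcomps v &
         gamma_kt (inflated F) k
         = \sum_(A in vcomps v) gamma_kt (inflated (induced A)) k]).
Proof.
split=> [F v k cutv kP|].
  have ltk : k < min_degree_vcomps v by case/andP: kP.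
  split; last exact: gamma_kt_leq_vcomps.
  have := vcomps_leq_gamma_kt cutv kP.
  rewrite -(big_morph Posz PoszD (erefl _)).
  by move: (\sum_(A in _) _) #|_| => s m; nia.
exists ex_graph, ex_center, 2; split; first exact: ex_cut_vertex.
  exact: ex_min_degree.
apply/eqP; rewrite eqn_leq gamma_kt_leq_vcomps ?ex_min_degree //=.
have [||R [sR domR <-]] := @arcs_gamma_kt ex_graph ex_graph id setT 2
  (@inj_id _) _ (imset_id_setT _).
- by [].
- apply: arcs_dominating => x _; have xi : x \in ex_side (side_of x).
    by rewrite inE eqxx orbT.
  apply: leq_trans (ex_side_degree xi) _; apply: subset_leq_card.
  by apply/subsetP=> z; rewrite !inE => /andP[].
apply: leq_trans (ex_arcs_leq sR domR); apply: leq_trans card_ex_arcs.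
(* The sizes of the traces of [ex_arcs] on the v-components add up to its own size, and each trace
   dominates its component. *)
rewrite -(@vcomps_sum_card ex_graph ex_center); last first.
  by apply/subsetP=> p; rewrite !inE => /andP[].
apply: leq_sum => A vA; apply: gamma_kt_vcomp_leq; first exact: subsetIr.
by have [i ->] := ex_vcomps vA; exact: ex_side_dominating.
Qed.
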